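(* Let $K$ be a field of characteristic zero and let $I$ be a homogeneous, zero-dimensional, Gorenstein ideal of $R=K[x_1,\ldots,x_d]$. Let $q$ be the monomial generator of $\mathrm{Soc}(I)$ modulo $I$, namely the smallest monomial, with respect to LEX, in $\mathrm{Soc}(I)\setminus I$. Then $I=\mathrm{Ann}_{\partial}(q)$ if and only if $I$ is a monomial ideal.
   Context: For an ideal $I$ of $R$, $\mathrm{Soc}(I)=(I:\mathfrak{m})$ where $\mathfrak{m}=(x_1,\ldots,x_d)$. $I$ is zero-dimensional if $R/I$ is finite-dimensional over $K$, and Gorenstein if $R/I$ is a Gorenstein ring; for a homogeneous zero-dimensional (proper) ideal this means that $\mathrm{Soc}(I)/I$ is one-dimensional over $K$. For such $I$ the set $\mathrm{Soc}(I)\setminus I$ always contains a monomial, whose class spans $\mathrm{Soc}(I)/I$. LEX is the lexicographical order on monomials with $x_1\prec x_2\prec\cdots\prec x_d$: first compare exponents of $x_d$, then in case of equality those of $x_{d-1}$, and so on. For $Q\in K[x_1,\ldots,x_d]$, writing $Q(t_1,\ldots,t_d)$ for the same polynomial in indeterminates $t_1,\ldots,t_d$, $$\mathrm{Ann}_{\partial}(Q):=\left\{f\in K[x_1,\ldots,x_d] : f\left(\tfrac{\partial}{\partial t_1},\ldots,\tfrac{\partial}{\partial t_d}\right)Q(t_1,\ldots,t_d)=0\right\}.$$ *)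

(* Defs.v *)
From HB Require Import structures.
From mathcomp Require Import all_boot all_order all_algebra.
From mathcomp Require Import mpoly.

Set Implicit Arguments.
Unset Strict Implicit.
Unset Printing Implicit Defensive.

Import GRing.Theory.
Local Open Scope ring_scope.

(* Conventions. The indeterminate x_(i+1) of K[x_1, ..., x_d] is 'X_i with    *)
(* i : 'I_d, and a monomial is given by its exponent vector m : 'X_{1..d},    *)
(* the corresponding polynomial being 'X_[m]. An ideal is an [idealr], which  *)
(* is proper by definition.                                                   *)

Section Ideals.
Variable R : comNzRingType.

Definition ideal_gen (G : R -> Prop) (f : R) : Prop :=
  exists (n : nat) (a g : 'I_n -> R),
    (forall i, G (g i)) /\ f = \sum_(i < n) a i * g i.

Definition generated_by (I : idealr R) (G : R -> Prop) : Prop :=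
  forall f : R, f \in I <-> ideal_gen G f.

Definition colon (I : idealr R) (J : R -> Prop) (f : R) : Prop :=
  forall g : R, J g -> f * g \in I.

End Ideals.

Section PolynomialIdeals.
Variables (K : fieldType) (d : nat).
Local Notation R := {mpoly K[d]}.

Definition irrelevant : R -> Prop :=
  ideal_gen (fun g : R => exists i : 'I_d, g = 'X_i).

Definition Soc (I : idealr R) : R -> Prop := colon I irrelevant.

Definition homogeneous_ideal (I : idealr R) : Prop :=
  exists2 G : R -> Prop,
    forall g, G g -> exists n : nat, g \is n.-homog & generated_by I G.

Definition monomial_ideal (I : idealr R) : Prop :=
  exists2 G : R -> Prop,
    forall g, G g -> exists m : 'X_{1..d}, g = 'X_[m] & generated_by I G.

(* R / I is spanned over K by finitely many classes. *)
Definition zero_dimensional (I : idealr R) : Prop :=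
  exists (n : nat) (b : 'I_n -> R),
    forall f : R, exists c : 'I_n -> K, f - \sum_(i < n) c i *: b i \in I.

(* Soc(I) / I is one-dimensional over K. For a homogeneous zero-dimensional   *)
(* ideal I, this is what it means for R / I to be a Gorenstein ring.          *)
Definition gorenstein (I : idealr R) : Prop :=
  exists2 s : R, Soc I s /\ s \notin I &
    forall f : R, Soc I f -> exists c : K, f - c *: s \in I.

(* LEX with x_1 < ... < x_d: the exponents of x_d are compared first.         *)
Definition lex_lt (m1 m2 : 'X_{1..d}) : bool :=
  [exists i : 'I_d, (m1 i < m2 i)%N &&
     [forall j : 'I_d, (i < j)%N ==> (m1 j == m2 j)]].

Definition lex_le (m1 m2 : 'X_{1..d}) : bool := (m1 == m2) || lex_lt m1 m2.

Definition monomial_generator (I : idealr R) (q : 'X_{1..d}) : Prop :=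
  (Soc I 'X_[q] /\ 'X_[q] \notin I) /\
  forall m : 'X_{1..d}, Soc I 'X_[m] -> 'X_[m] \notin I -> lex_le q m.

(* f(d/dt_1, ..., d/dt_d) Q *)
Definition diff_apply (f Q : R) : R := \sum_(m <- msupp f) f@_m *: Q^`M[m].

Definition Ann_partial (Q : R) : {pred R} := fun f => diff_apply f Q == 0.

End PolynomialIdeals.

(* Main.v *)
Require Import Defs.
From mathcomp Require Import all_boot all_order all_algebra.
From mathcomp Require Import mpoly.
Local Open Scope ring_scope.

(** In characteristic zero, [Ann_partial 'X_[q]] is the span of the monomials
    not dividing q, hence a monomial ideal.  Conversely, let I be monomial.
    Monomials outside I are linearly independent modulo I, so finitely many of
    them exist and each divides a maximal one, which lies in the socle.  As the
    socle is one-dimensional modulo I, that maximal monomial is q; so the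
    monomials outside I are exactly the divisors of q. *)

Set Implicit Arguments.
Unset Strict Implicit.
Unset Printing Implicit Defensive.

Import GRing.Theory.

Lemma ideal_gen_in (R : comNzRingType) (I : idealr R) (G : R -> Prop) (f : R) :
  (forall g, G g -> g \in I) -> ideal_gen G f -> f \in I.
Proof.
move=> GI [n [a [g [Gg ->]]]]; apply: rpred_sum => i _.
by apply: idealMr; apply: GI.
Qed.

Lemma ideal_gen_sub (R : comNzRingType) (G : R -> Prop) (g : R) :
  G g -> ideal_gen G g.
Proof.
move=> Gg; exists 1%N, (fun=> 1), (fun=> g); split=> //.
by rewrite big_ord1 mul1r.
Qed.

Section MonomialsOfIdeals.
Variables (K : fieldType) (d : nat).
Local Notation R := {mpoly K[d]}.
Implicit Types (I : idealr R) (f : R) (m q : 'X_{1..d}).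

Lemma idealr_scale I (c : K) f : f \in I -> c *: f \in I.
Proof. by rewrite -mul_mpolyC; apply: idealMr. Qed.

Lemma idealr_mpolyX_le I m q :
  (m <= q)%MM -> 'X_[m] \in I -> ('X_[q] : R) \in I.
Proof. by move=> le_mq mI; rewrite -(submK le_mq) mpolyXD; apply: idealMr. Qed.

Lemma idealr_msupp I f : {in msupp f, forall m, ('X_[m] : R) \in I} -> f \in I.
Proof.
move=> fI; rewrite [f]mpolyE big_seq; apply: rpred_sum => m /fI mI.
exact: idealr_scale.
Qed.

(** A monomial of $\sum_i a_i g_i$ must occur in some summand $a_i g_i$, and there it is a multiple
    of the monomial $g_i$. *)
Lemma monomial_ideal_msupp I f m :
  monomial_ideal I -> f \in I -> m \in msupp f -> ('X_[m] : R) \in I.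
Proof.
case=> G Gmon genG /genG[n [a [g [Gg ->]]]].
rewrite mcoeff_msupp raddf_sum /= => nz.
have [i nz_i]: exists i, (a i * g i)@_m != 0.
  apply/existsP; apply: contraNT nz; rewrite negb_exists => /forallP z.
  by rewrite big1 // => i _; apply/eqP; move: (z i); rewrite negbK.
have [k gE] := Gmon _ (Gg i).
have kI : ('X_[k] : R) \in I by apply/genG; rewrite -gE; apply: ideal_gen_sub.
apply: idealr_mpolyX_le kI; move: nz_i; rewrite gE -mcoeff_msupp => msa.
have /allpairsP[[m1 m2] /= [_ ]] := msuppM_le msa.
by rewrite msuppX inE => /eqP -> ->; apply: lem_addl.
Qed.

Lemma Soc_mpolyX I m :
  (forall i : 'I_d, ('X_[m + U_(i)] : R) \in I) -> Soc I 'X_[m].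
Proof.
move=> mI _ [n [a [g [Gg ->]]]]; rewrite mulr_sumr; apply: rpred_sum => i _.
by have [j ->] := Gg i; rewrite mulrCA -mpolyXD; apply: idealMr.
Qed.

(** The coordinates of the n+1 classes form a matrix with more rows than columns, so some nonzero
    row vector kills it on the left. Injectivity of [M] keeps the resulting combination of monomials
    from collapsing. *)
Lemma mpolyX_dependent_mod I (n : nat) (M : 'I_n.+1 -> 'X_{1..d}) :
  (exists b : 'I_n -> R,
    forall f, exists c : 'I_n -> K, f - \sum_(i < n) c i *: b i \in I) ->
  injective M ->
  exists2 f, f \in I & exists k, M k \in msupp f.
Proof.
case=> b bP injM; have [c cP] := fin_all_exists (fun k => bP 'X_[M k]).
pose C := \matrix_(k < n.+1, i < n) c k i.
have: kermx C != 0.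
  rewrite kermx_eq0 /row_free neq_ltn.
  by rewrite (leq_ltn_trans (rank_leq_col C)).
case/rowV0Pn=> v /sub_kermxP vC /rV0Pn[k nz_vk].
exists (\sum_j v 0 j *: 'X_[M j]); last first.
  exists k; rewrite mcoeff_msupp raddf_sum /= (bigD1 k) //= big1.
    by rewrite mcoeffZ mcoeffX eqxx mulr1 addr0.
  move=> j ne_jk; rewrite mcoeffZ mcoeffX; case: eqP => [/injM|].
    by move/eqP: ne_jk.
  by rewrite mulr0.
(* The subtracted terms add up to zero because [v *m C = 0]; each remaining bracket lies in [I]. *)
have -> : \sum_j v 0 j *: 'X_[M j] =
    \sum_j v 0 j *: ('X_[M j] - \sum_(i < n) c j i *: b i).
  under [RHS]eq_bigr do rewrite scalerBr scaler_sumr.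
  rewrite sumrB exchange_big /= [X in _ - X]big1 ?subr0 // => i _.
  under eq_bigr do rewrite scalerA.
  rewrite -scaler_suml; move/rowP/(_ i): vC; rewrite !mxE => vC.
  by under eq_bigr => j _ do [have -> : c j i = C j i by rewrite mxE];
    rewrite vC scale0r.
by apply: rpred_sum => j _; apply: idealr_scale.
Qed.

Lemma monomial_ideal_le_Soc I m :
  zero_dimensional I -> monomial_ideal I -> ('X_[m] : R) \notin I ->
  exists2 q, (m <= q)%MM & Soc I 'X_[q] /\ ('X_[q] : R) \notin I.
Proof.
move=> [n bP] monI mI.
(* [up] multiplies by a variable whenever the product stays outside [I]; by default it leaves a
   monomial of the socle fixed. *)
pose up q := odflt q
  (omap (fun i => q + U_(i))%MM [pick i : 'I_d | ('X_[q + U_(i)] : R) \notin I]).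
pose M k := iter k up m.
have MP k : (m <= M k)%MM && (('X_[M k] : R) \notin I).
  elim: k => [|k /andP[le_mM MI]]; first by rewrite lepm_refl mI.
  rewrite /M iterS -/(M k) /up; case: pickP => [i /= -> | _ /=].
    by rewrite (lepm_trans le_mM) ?lem_addr.
  by rewrite le_mM MI.
case: (boolP [exists k : 'I_n.+1, [forall i, ('X_[M k + U_(i)] : R) \in I]]).
  case/existsP=> k /forallP sM; have /andP[le_mM MI] := MP k.
  by exists (M k) => //; split=> //; apply: Soc_mpolyX.
rewrite negb_exists => /forallP nmax.
(* If none of [M 0], ..., [M n] is maximal, the degree rises at every step, so these n+1 monomials
   are distinct, too many for a quotient spanned by n classes. *)
have degM k : (k <= n)%N -> mdeg (M k) = (mdeg m + k)%N.
  elim: k => [_ | k IHk lt_kn]; first by rewrite addn0.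
  rewrite /M iterS -/(M k) /up; case: pickP => [i _ /= | no].
    by rewrite mdegD mdeg1 IHk 1?ltnW // addn1 addnS.
  have /negP[] := nmax (Ordinal (ltnW lt_kn : (k < n.+1)%N)).
  by apply/forallP=> i; apply: negbFE; apply: no.
have injM : injective (fun k : 'I_n.+1 => M k).
  move=> j k /= /(congr1 mdeg).
  by rewrite (degM j (ltn_ord j)) (degM k (ltn_ord k)) => /addnI/val_inj.
have [f fI [k fk]] := mpolyX_dependent_mod bP injM.
have /andP[_ /negP[]] := MP k; exact: monomial_ideal_msupp fI fk.
Qed.

(** Modulo [I] both monomials are multiples of [s], so cross-multiplying gives a binomial in [I].
    For distinct monomials, both would occur in it or at least [m] would, since [e] is nonzero,
    which forces ['X_[m]] into [I]. *)
Lemma monomial_ideal_gorenstein_Soc I m q :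
  monomial_ideal I -> gorenstein I ->
  Soc I 'X_[m] -> ('X_[m] : R) \notin I ->
  Soc I 'X_[q] -> ('X_[q] : R) \notin I -> m = q.
Proof.
move=> monI [s [_ sI] span] /span[c cP] mI /span[e eP] qI.
have e_neq0 : e != 0.
  by apply: contraNneq qI => e0; move: eP; rewrite e0 scale0r subr0.
apply/eqP; apply: contraNT mI => ne_mq.
apply: (@monomial_ideal_msupp _ (e *: 'X_[m] - c *: 'X_[q])) => //; last first.
  rewrite mcoeff_msupp mcoeffB !mcoeffZ !mcoeffX eqxx mulr1 (eq_sym q).
  by rewrite (negPf ne_mq) mulr0 subr0.
have -> : e *: 'X_[m] - c *: 'X_[q] =
    e *: ('X_[m] - c *: s) - c *: ('X_[q] - e *: s).
  by rewrite !scalerBr !scalerA (mulrC c e) opprB addrA subrK.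
by apply: rpredB; apply: idealr_scale.
Qed.

Lemma mnm_lepN m q : ~~ (m <= q)%MM -> exists i, (q i < m i)%N.
Proof.
move=> nle_mq; apply/existsP; apply: contraNT nle_mq; rewrite negb_exists.
by move/forallP=> le_mq; apply/mnm_lepP => i; rewrite leqNgt.
Qed.

(** Distinct divisors [k] of [q] yield distinct [q - k], so nothing can cancel the term of [m]. *)
Lemma mcoeff_diff_apply_mpolyX f q m :
  (m <= q)%MM ->
  (diff_apply f 'X_[q])@_(q - m) = f@_m * (\prod_(i < d) q i ^_ m i)%:R.
Proof.
move=> le_mq; rewrite /diff_apply raddf_sum /=.
have term k : (f@_k *: ('X_[q] : R)^`M[k])@_(q - m) =
    (if k == m then f@_m * (\prod_(i < d) q i ^_ m i)%:R else 0).
  rewrite mderivmX !mcoeffZ mcoeffX.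
  case: (eqVneq k m) => [-> | ne_km]; first by rewrite eqxx mulr1.
  (* Truncated subtraction may give [q - k = q - m] when [k] does not divide [q], but then a falling
     factorial vanishes. *)
  case: (boolP (k <= q)%MM) => [le_kq | /mnm_lepN[i lt_qk]].
    case: eqP => [eq_sub | _]; last by rewrite !mulr0.
    have := submK le_kq; rewrite eq_sub -{2}(submK le_mq) => /addmI.
    by move/eqP: ne_km.
  by rewrite (bigD1 i) //= ffact_small // mul0n mul0r mulr0.
under eq_bigr do rewrite term.
case: (boolP (m \in msupp f)) => fm.
  by rewrite (bigD1_seq m) ?msupp_uniq //= eqxx [X in _ + X]big1 ?addr0 // => k /negPf->.
by rewrite (memN_msupp_eq0 fm) !mul0r big1 // => k _; case: ifP.
Qed.

(** For [m] dividing [q] the product of falling factorials is a positive integer, hence nonzero in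
    characteristic zero. *)
Lemma Ann_partial_mpolyX f q :
  [pchar K] =i pred0 ->
  (f \in Ann_partial 'X_[q]) = all (fun m => ~~ (m <= q)%MM) (msupp f).
Proof.
move=> charK0; apply/eqP/allP => [f0 m | nle].
  rewrite mcoeff_msupp; apply: contraNN => le_mq.
  have /eqP := mcoeff_diff_apply_mpolyX f le_mq.
  rewrite f0 mcoeff0 eq_sym mulf_eq0 => /orP[// |].
  rewrite ((pcharf0P _).1 charK0) -leqn0 leqNgt prodn_gt0 // => i.
  by rewrite ffact_gt0; move/mnm_lepP: le_mq.
rewrite /diff_apply big_seq big1 // => m /nle /mnm_lepN[i lt_qm].
by rewrite mderivmX (bigD1 i) //= ffact_small // mul0n scale0r scaler0.
Qed.

Lemma monomial_ideal_of_msupp I :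
  (forall f m, f \in I -> m \in msupp f -> ('X_[m] : R) \in I) ->
  monomial_ideal I.
Proof.
(* All monomials of [I] serve as generators. *)
move=> suppI; exists (fun g => g \in I /\ exists m, g = 'X_[m]) => [g [_ //]|f].
split=> [fI | ]; last by apply: ideal_gen_in => g [].
exists (size (msupp f)), (fun k => (f@_(tnth (in_tuple (msupp f)) k))%:MP).
exists (fun k => 'X_[tnth (in_tuple (msupp f)) k]); split=> [k|].
  split; last by eexists.
  exact: suppI fI (mem_tnth k (in_tuple (msupp f))).
rewrite [LHS]mpolyE (big_tnth _ _ (msupp f)).
by apply: eq_bigr => k _; rewrite mul_mpolyC.
Qed.

End MonomialsOfIdeals.

Theorem corollary6p12 (K : fieldType) (charK0 : [pchar K] =i pred0) (d : nat)
    (I : idealr {mpoly K[d]}) (homI : homogeneous_ideal I)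
    (zdimI : zero_dimensional I) (gorI : gorenstein I)
    (q : 'X_{1..d}) (hq : monomial_generator I q) :
  I =i Ann_partial ('X_[q] : {mpoly K[d]}) <-> monomial_ideal I.
Proof.
have AnnE f := Ann_partial_mpolyX f q charK0.
split=> [IE | monI].
  apply: monomial_ideal_of_msupp => f m; rewrite !IE !AnnE => /allP nle /nle nle_mq.
  by rewrite msuppX /= nle_mq.
have [[socq qI] _] := hq => f; rewrite AnnE; apply/idP/allP => [fI m fm | nle].
  apply: contra qI => /idealr_mpolyX_le; apply.
  exact: monomial_ideal_msupp fI fm.
apply: idealr_msupp => m /nle; apply: contraR => mI.
(* The socle monomial [p] above [m] can only be [q], so [m] divides [q]. *)
have [p le_mp [socp pI]] := monomial_ideal_le_Soc zdimI monI mI.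
by rewrite -(monomial_ideal_gorenstein_Soc monI gorI socp pI socq qI).
Qed.
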